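(* Let $\tau\in C_b(\mathbb{R})$, let $\alpha$ be a homeomorphism of $\mathbb{R}$ with $\tau\circ\alpha=\tau$, and let $w\in C_b(\mathbb{R})$ with $w>0$ and $\|w^{-1}\|_\infty<\infty$. Let $T_{\alpha,w}:\mathcal{A}_\tau\to\mathcal{A}_\tau$, $T_{\alpha,w}(f)=w\cdot(f\circ\alpha)$. Then the following are equivalent: (1) $T_{\alpha,w}$ is hypercyclic on $\mathcal{A}_\tau$. (2) For every $\epsilon\in(0,1)$ and every compact subset $K\subseteq|\tau|^{-1}([0,\epsilon])$ there exists a strictly increasing sequence $(n_k)$ in $\mathbb{N}$ such that $$\lim_{k\to\infty}\Big(\sup_{t\in K}\Big|\prod_{j=0}^{n_k-1}(w\circ\alpha^{j-n_k})(t)\Big|\Big)=\lim_{k\to\infty}\Big(\sup_{t\in K}\Big|\prod_{j=0}^{n_k-1}(w\circ\alpha^{j})^{-1}(t)\Big|\Big)=0.$$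
   Context: $\mathcal{A}=C_0(\mathbb{R})$ with the sup norm, and the Segal algebra corresponding to $\tau$ is $\mathcal{A}_\tau=\{f\in\mathcal{A}:\sum_{k=0}^\infty\|f\tau^k\|_\infty<\infty\}$, a Banach algebra with norm $\|f\|_\tau=\sum_{k=0}^\infty\|f\tau^k\|_\infty$. $w^{-1}$ and $(w\circ\alpha^j)^{-1}$ denote pointwise reciprocals, while $|\tau|^{-1}(E)$ denotes the preimage of $E$ under $|\tau|$; $\alpha^m$ ($m\in\mathbb{Z}$) are iterates of $\alpha$. A bounded operator $T$ on a Banach space $\mathcal{X}$ is hypercyclic if there is $x\in\mathcal{X}$ with $\{T^nx:n\ge0\}$ dense in $\mathcal{X}$. Standing assumption: the Banach space on which the operator acts is separable and infinite-dimensional. A supremum of non-negative quantities over the empty set is $0$. *)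

(* Defs.v *)
From HB Require Import structures.
From mathcomp Require Import all_boot all_order all_algebra.
From mathcomp Require Import all_classical all_reals all_analysis.
From mathcomp Require Import complex.
Set Implicit Arguments.
Unset Strict Implicit.
Unset Printing Implicit Defensive.
Import Order.TTheory GRing.Theory Num.Theory numFieldNormedType.Exports.
Local Open Scope classical_set_scope.
Local Open Scope ring_scope.

(* The real-valued modulus of a complex number; the generic norm `|z| is
   R[i]-valued. *)
Notation cmod := (@ComplexField.Normc.normc _).

Section cmod.
Context {R : realType}.
Implicit Types z : R[i].

Lemma cmodE z : `|z| = (cmod z)%:C%C.
Proof. by []. Qed.

Lemma cmod_ge0 z : 0 <= cmod z.
Proof. by case: z => a b; exact: sqrtr_ge0. Qed.

Lemma cmodD z1 z2 : cmod (z1 + z2) <= cmod z1 + cmod z2.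
Proof. exact: le_normcD. Qed.

Lemma cmodM z1 z2 : cmod (z1 * z2) = cmod z1 * cmod z2.
Proof. exact: ComplexField.Normc.normcM. Qed.

Lemma cmodB z1 z2 : cmod (z1 - z2) = cmod (z2 - z1).
Proof. by rewrite -opprB normcN. Qed.

Lemma cmodTri z1 z2 z3 : cmod (z1 - z3) <= cmod (z1 - z2) + cmod (z2 - z3).
Proof. by rewrite (_ : z1 - z3 = (z1 - z2) + (z2 - z3)) ?cmodD// addrA subrK. Qed.

Lemma complex_gt0E (e : R[i]) : 0 < e -> e = (complex.Re e)%:C%C /\ 0 < complex.Re e.
Proof.
by case: e => a b; rewrite ltcE /= => /andP[/eqP -> a0].
Qed.

Lemma cvg_cmodP {T : Type} (F : set_system T) {FF : Filter F} (f : T -> (R[i])^o) (l : (R[i])^o) :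
  f @ F --> l <-> forall e : R, 0 < e -> \forall t \near F, cmod (l - f t) < e.
Proof.
split=> [/cvgrPdist_lt h e e0|h].
  have e0' : 0 < (e%:C%C : R[i]) by rewrite ltcR.
  have := h _ e0'; apply: filterS => t.
  by rewrite [X in X < _]cmodE ltcR.
apply/cvgrPdist_lt => e /complex_gt0E[-> e0].
have := h _ e0; apply: filterS => t.
by rewrite [X in _ -> X < _]cmodE ltcR.
Qed.

Lemma cmod_continuous : continuous (cmod : (R[i])^o -> R).
Proof.
move=> z; apply/(@cvgrPdist_lt _ R^o _ (nbhs (z : (R[i])^o))) => e e0.
have := (@cvg_cmodP _ (nbhs (z : (R[i])^o)) (nbhs_filter (z : (R[i])^o)) id z).1 (@cvg_id _ _) e e0.
apply: (@filterS _ _ (nbhs_filter (z : (R[i])^o))) => t h; apply: le_lt_trans h.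
have h1 := cmodD (z - t) t; have h2 := cmodD (t - z) z.
rewrite !subrK in h1 h2; rewrite ler_norml lerBlDr h1 andbT.
by rewrite lerNl opprB lerBlDr cmodB.
Qed.

End cmod.

Section function_spaces.
Context {R : realType}.
Implicit Types f g : R -> (R[i])^o.

Definition supnorm f : \bar R := ereal_sup [set (cmod (f t))%:E | t in [set: R]].

(* Scalars are complex; a w in C_b with 0 < w t for the order of R[i] is
   real-valued and positive. *)
Definition C_b : set (R -> (R[i])^o) :=
  [set f : R -> (R[i])^o | continuous f /\ (supnorm f < +oo)%E].

Definition C_0 : set (R -> (R[i])^o) :=
  [set f : R -> (R[i])^o |
    continuous f /\ forall e : R, 0 < e -> compact [set t | e <= cmod (f t)]].

Lemma supnorm_ub f t : ((cmod (f t))%:E <= supnorm f)%E.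
Proof. by apply: ereal_sup_ubound; exists t. Qed.

Lemma supnorm_le f (M : \bar R) :
  (forall t, (cmod (f t))%:E <= M)%E -> (supnorm f <= M)%E.
Proof. by move=> h; apply: ge_ereal_sup => _ [t _ <-]. Qed.

Lemma supnorm_ge0 f : (0 <= supnorm f)%E.
Proof. by apply: le_trans (supnorm_ub f 0); rewrite lee_fin cmod_ge0. Qed.

Lemma supnorm_fin f : (supnorm f < +oo)%E ->
  exists2 M : R, 0 < M & forall t, cmod (f t) <= M.
Proof.
move=> fy.
have ffin : supnorm f \is a fin_num by rewrite ge0_fin_numE// supnorm_ge0.
have h t : cmod (f t) <= fine (supnorm f).
  by rewrite -lee_fin fineK// supnorm_ub.
exists (fine (supnorm f) + 1).
  by rewrite ltr_wpDl// fine_ge0// supnorm_ge0.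
by move=> t; apply: (le_trans (h t)); rewrite lerDl.
Qed.

Lemma closed_cmod_ge f (e : R) : continuous f -> closed [set t | e <= cmod (f t)].
Proof.
move=> fc.
have -> : [set t | e <= cmod (f t)] = (fun t => cmod (f t)) @^-1` [set x | e <= x].
  by [].
apply: preimage_closed; last exact: closed_ge.
by move=> t _; apply: continuous_comp; [exact: fc|exact: cmod_continuous].
Qed.

Lemma C_0_scaleD (c : R[i]) f g : C_0 f -> C_0 g -> C_0 (c *: f + g).
Proof.
move=> [fc f0] [gc g0]; have hc : continuous (c *: f + g).
  move=> t; apply: (@continuousD _ _ _ (c *: f)); last exact: gc.
  exact: (continuousM (@cst_continuous _ _ _ _) (fc t)).
split=> // e e0.
have e2 : 0 < e / 2 by rewrite divr_gt0.
have d0 : 0 < e / 2 / (cmod c + 1) by rewrite divr_gt0// ltr_wpDl// cmod_ge0.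
apply: (subclosed_compact (closed_cmod_ge hc) (compactU (f0 _ d0) (g0 _ e2))).
move=> t /= et; have [h|h] := leP (e / 2) (cmod (g t)); [by right|left].
rewrite leNgt; apply/negP => h'.
have : cmod (c * f t + g t) < e.
  apply: le_lt_trans (cmodD _ _) _; rewrite [ltRHS](splitr e) ltrD//.
  rewrite cmodM; apply: (@le_lt_trans _ _ ((cmod c + 1) * cmod (f t))).
    by rewrite ler_wpM2r ?cmod_ge0// lerDl.
  by rewrite mulrC -ltr_pdivlMr// ltr_wpDl// cmod_ge0.
by rewrite ltNge et.
Qed.

Lemma C_0_0 : C_0 (0 : R -> (R[i])^o).
Proof.
split; first exact: cst_continuous.
move=> e e0; rewrite (_ : [set _ | _] = set0); first exact: compact0.
rewrite -subset0 => t /=; change (e <= cmod (0 : R[i]) -> False).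
by rewrite ComplexField.Normc.normc0 leNgt e0.
Qed.

End function_spaces.

Section segal.
Context {R : realType}.
Variable tau : R -> (R[i])^o.
Implicit Types f g : R -> (R[i])^o.

Definition segal_norm f : \bar R :=
  (\sum_(0 <= k <oo) supnorm (fun t => f t * tau t ^+ k)%R)%E.

Lemma segal_norm_ge0 f : (0 <= segal_norm f)%E.
Proof. by apply: nneseries_ge0 => k _ _; exact: supnorm_ge0. Qed.

Lemma segal_norm_scaleD (c : R[i]) f g :
  (segal_norm (c *: f + g)%R <= (cmod c)%:E * segal_norm f + segal_norm g)%E.
Proof.
rewrite /segal_norm -nneseriesZl; last by move=> k _; exact: supnorm_ge0.
rewrite -nneseriesD; last 2 first.
- by move=> k _ _; rewrite mule_ge0 ?supnorm_ge0// lee_fin cmod_ge0.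
- by move=> k _ _; exact: supnorm_ge0.
apply: lee_nneseries => [k _ _|k _]; first exact: supnorm_ge0.
apply: supnorm_le => t.
change ((cmod ((c * f t + g t) * tau t ^+ k)%R)%:E <=
  (cmod c)%:E * supnorm (fun t => f t * tau t ^+ k)%R + supnorm (fun t => g t * tau t ^+ k)%R)%E.
rewrite mulrDl -mulrA; apply: (@le_trans _ _
  ((cmod c)%:E * (cmod (f t * tau t ^+ k)%R)%:E + (cmod (g t * tau t ^+ k)%R)%:E)%E).
  by rewrite -EFinM -EFinD lee_fin -cmodM; exact: cmodD.
apply: leeD; last exact: (supnorm_ub (fun t => g t * tau t ^+ k)%R).
apply: lee_wpmul2l; first by rewrite lee_fin cmod_ge0.
exact: (supnorm_ub (fun t => f t * tau t ^+ k)%R).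
Qed.

Lemma segal_norm0 : segal_norm 0 = 0%E.
Proof.
rewrite /segal_norm eseries0// => k _ _; apply/eqP; rewrite eq_le supnorm_ge0 andbT.
by apply: supnorm_le => t; rewrite mul0r ComplexField.Normc.normc0.
Qed.

Lemma supnorm_le_segal_norm f k :
  (supnorm (fun t => f t * tau t ^+ k)%R <= segal_norm f)%E.
Proof.
apply: (le_trans _ (nneseries_lim_ge k.+1 _)); last by move=> *; exact: supnorm_ge0.
rewrite big_nat_recr//= leeDr// sume_ge0// => i _; exact: supnorm_ge0.
Qed.

Definition in_segal : {pred R -> (R[i])^o} :=
  fun f => `[< C_0 f /\ (segal_norm f < +oo)%E >].

Lemma in_segalP f : reflect (C_0 f /\ (segal_norm f < +oo)%E) (f \in in_segal).
Proof. exact: asboolP. Qed.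

Lemma in_segal_submod : submod_closed in_segal.
Proof.
split; first by apply/in_segalP; rewrite segal_norm0; split => //; exact: C_0_0.
move=> c f g /in_segalP[f0 ff] /in_segalP[g0 gf]; apply/in_segalP; split.
  exact: C_0_scaleD.
apply: le_lt_trans (segal_norm_scaleD _ _ _) _.
have ffin : segal_norm f \is a fin_num by rewrite ge0_fin_numE// segal_norm_ge0.
by rewrite -(fineK ffin) -EFinM lte_add_pinfty// ltry.
Qed.

(* The underlying Banach space of the Segal algebra A_tau. The norm is computed
   in \bar R, so that tau need not be assumed continuous or bounded here. *)
Record segal := Segal {
  segal_fun :> R -> (R[i])^o;
  segal_subproof : segal_fun \in in_segal }.

HB.instance Definition _ := [isSub for segal_fun].
HB.instance Definition _ := [Choice of segal by <:].
HB.instance Definition _ := GRing.isSubmodClosed.Build _ _ in_segal in_segal_submod.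
HB.instance Definition _ := [SubChoice_isSubLmodule of segal by <:].

End segal.

Section segal_normed.
Context {R : realType} (tau : R -> (R[i])^o).
Implicit Types f g h : segal tau.

Lemma segal_fin f : segal_norm tau f \is a fin_num.
Proof.
by have /in_segalP[_ fy] := segal_subproof f; rewrite ge0_fin_numE// segal_norm_ge0.
Qed.

Definition segal_rnorm f : R := fine (segal_norm tau f).

Lemma segal_rnormE f : (segal_rnorm f)%:E = segal_norm tau f.
Proof. by rewrite fineK// segal_fin. Qed.

Lemma segal_rnorm_scaleD (c : R[i]) f g :
  segal_rnorm (c *: f + g) <= cmod c * segal_rnorm f + segal_rnorm g.
Proof. by rewrite -lee_fin EFinD EFinM !segal_rnormE; exact: segal_norm_scaleD. Qed.

Lemma cmod_le_segal_rnorm f t : cmod (f t) <= segal_rnorm f.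
Proof.
rewrite -lee_fin segal_rnormE; apply: le_trans (supnorm_le_segal_norm tau f 0).
by apply: le_trans (supnorm_ub _ t); rewrite expr0 mulr1.
Qed.

Lemma segal_rnormD f g : segal_rnorm (f + g) <= segal_rnorm f + segal_rnorm g.
Proof.
by have := segal_rnorm_scaleD 1 f g; rewrite scale1r ComplexField.Normc.normc1 mul1r.
Qed.

Lemma segal_rnorm0 : segal_rnorm 0 = 0.
Proof. by rewrite /segal_rnorm (segal_norm0 tau). Qed.

Lemma segal_rnormZ (c : R[i]) f : segal_rnorm (c *: f) = cmod c * segal_rnorm f.
Proof.
have le d g : segal_rnorm (d *: g) <= cmod d * segal_rnorm g.
  by have := segal_rnorm_scaleD d g 0; rewrite addr0 segal_rnorm0 addr0.
have [->|c0] := eqVneq c 0.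
  by rewrite scale0r segal_rnorm0 ComplexField.Normc.normc0 mul0r.
apply/eqP; rewrite eq_le le /=.
have := le c^-1 (c *: f); rewrite scalerA mulVf// scale1r => h.
have c1 : cmod c * cmod c^-1 = 1 by rewrite -cmodM mulfV// ComplexField.Normc.normc1.
have := ler_wpM2l (cmod_ge0 c) h.
by rewrite mulrA c1 mul1r.
Qed.

Definition segal_cnorm f : R[i] := (segal_rnorm f)%:C%C.

Lemma segal_cnormD f g : segal_cnorm (f + g) <= segal_cnorm f + segal_cnorm g.
Proof. by rewrite /segal_cnorm -rmorphD lecR segal_rnormD. Qed.

Lemma segal_cnormZ (c : R[i]) f : segal_cnorm (c *: f) = `|c| * segal_cnorm f.
Proof. by rewrite /segal_cnorm segal_rnormZ rmorphM. Qed.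

Lemma segal_cnorm_eq0 f : segal_cnorm f = 0 -> f = 0.
Proof.
move=> [f0]; apply/val_inj/funext => t.
apply: (@ComplexField.Normc.eq0_normc R); apply/eqP; rewrite eq_le cmod_ge0 andbT.
by rewrite -f0; exact: cmod_le_segal_rnorm.
Qed.

HB.instance Definition _ := Lmodule_isNormed.Build R[i] (segal tau)
  segal_cnormD segal_cnormZ segal_cnorm_eq0.

Lemma segal_normE f : `|f| = (fine (segal_norm tau f))%:C%C.
Proof. by []. Qed.

End segal_normed.

Section segal_complete.
Context {R : realType} (tau : R -> (R[i])^o).
Variables (F : set_system (segal tau)) (FF : ProperFilter F) (Fc : cauchy F).

Let Fball (d : R) : 0 < d ->
  exists x : segal tau, F [set h | segal_rnorm (x - h) < d].
Proof.
move=> d0; have /cauchyP : cauchy F by [].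
have d0' : 0 < (d%:C%C : R[i]) by rewrite ltcR.
move=> /(_ _ d0')[x Fx]; exists x; move: Fx; rewrite -ball_normE.
by apply: filterS => h /=; rewrite segal_normE ltcR.
Qed.

Let Fdiam (d : R) : 0 < d ->
  exists2 A, F A & forall g h : segal tau, A g -> A h -> segal_rnorm (g - h) < d.
Proof.
move=> d0; have [|x Fx] := @Fball (d / 2); first by rewrite divr_gt0.
exists [set h | segal_rnorm (x - h) < d / 2] => // g h /= xg xh.
rewrite [ltRHS](splitr d) (_ : g - h = (-1) *: (x - g) + (x - h)).
  apply: le_lt_trans (segal_rnorm_scaleD _ _ _) _.
  by rewrite normcN ComplexField.Normc.normc1 mul1r ltrD.
by rewrite scaleN1r opprB addrA subrK.
Qed.

Let Fpt (p : R[i] -> R) : (forall y z, `|p y - p z| <= cmod (y - z)) ->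
  forall t, exists l : R, forall e, 0 < e -> F [set h | `|l - p (h t)| < e].
Proof.
move=> pl t; pose G := (fun h : segal tau => p (h t)) @ F.
have GF : ProperFilter G by exact: fmap_proper_filter.
have : cvg G.
  apply: R_complete; apply/cauchyP => e e0.
  have [x Fx] := Fball e0; exists (p (x t)); rewrite -ball_normE.
  rewrite /G /fmap /=; move: Fx; apply: filterS => h /=; apply: le_lt_trans.
  exact: le_trans (pl _ _) (cmod_le_segal_rnorm (x - h) t).
move=> /cvg_ex[l Gl]; exists l => e e0.
by have /cvgrPdist_lt/(_ e e0) := Gl.
Qed.

Let cmod_Re_Im (z : R[i]) : `|complex.Re z| <= cmod z /\ `|complex.Im z| <= cmod z.
Proof.
case: z => a b /=; rewrite -!sqrtr_sqr; split; apply: ler_wsqrtr.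
  by rewrite lerDl sqr_ge0.
by rewrite lerDr sqr_ge0.
Qed.

Let cmod_le (a b : R) : cmod (a +i* b)%C <= `|a| + `|b|.
Proof.
rewrite /= -[leRHS]ger0_norm ?addr_ge0// -sqrtr_sqr; apply: ler_wsqrtr.
rewrite sqrrD !real_normK ?num_real// -addrA lerD2l lerDr mulrn_wge0// mulr_ge0.
Qed.

Let Flim : exists f : R -> (R[i])^o,
  forall t e, 0 < e -> F [set h : segal tau | cmod (f t - h t) < e].
Proof.
have /choice[a ah] := @Fpt (@complex.Re R) (fun y z =>
  ltac:(rewrite -raddfB; exact: (cmod_Re_Im (y - z)).1)).
have /choice[b bh] := @Fpt (@complex.Im R) (fun y z =>
  ltac:(rewrite -raddfB; exact: (cmod_Re_Im (y - z)).2)).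
exists (fun t => (a t +i* b t)%C) => t e e0.
have e2 : 0 < e / 2 by rewrite divr_gt0.
apply: filterS (filterI (ah t _ e2) (bh t _ e2)) => h /= [h1 h2].
rewrite (_ : _ - _ = ((a t - complex.Re (h t)) +i* (b t - complex.Im (h t)))%C); last first.
  by case: (h t).
by apply: le_lt_trans (cmod_le _ _) _; rewrite [ltRHS](splitr e) ltrD.
Qed.

Lemma segal_cauchy_cvg : cvg F.
Proof.
have [f fP] := Flim.
have U d : 0 < d -> F [set h : segal tau |
    forall k t, cmod ((h t - f t) * tau t ^+ k) <= d].
  move=> d0; have [A FA AP] := Fdiam d0; apply: (filterS _ FA) => h Ah k t /=.
  apply/ler_addgt0Pr => e e0.
  have e1 : 0 < e / (cmod (tau t ^+ k) + 1) by rewrite divr_gt0// ltr_wpDl// cmod_ge0.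
  have [g [Ag gt]] := filter_ex (filterI FA (fP t _ e1)).
  rewrite (_ : _ * _ = (h t - g t) * tau t ^+ k + (g t - f t) * tau t ^+ k); last first.
    by rewrite -mulrDl addrA subrK.
  apply: le_trans (cmodD _ _) _; apply: lerD.
    apply: (@le_trans _ _ (segal_rnorm (h - g))); last exact/ltW/AP.
    rewrite -lee_fin segal_rnormE.
    apply: le_trans (supnorm_le_segal_norm tau (h - g) k).
    exact: (supnorm_ub (fun t => (h - g) t * tau t ^+ k) t).
  rewrite cmodM cmodB; apply: (@le_trans _ _ (cmod (f t - g t) * (cmod (tau t ^+ k) + 1))).
    by rewrite ler_wpM2l ?cmod_ge0// lerDl.
  by rewrite -ler_pdivlMr ?ltW// ltr_wpDl// cmod_ge0.
have S e : 0 < e -> F [set h : segal tau | (segal_norm tau ((h : R -> (R[i])^o) - f)%R <= e%:E)%E].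
  move=> e0; have [A FA AP] := Fdiam e0; apply: (filterS _ FA) => h Ah /=.
  apply: lime_le; first by apply: is_cvg_nneseries => *; exact: supnorm_ge0.
  apply: nearW => n; apply/lee_addgt0Pr => d d0.
  have d1 : 0 < d / n.+1%:R by rewrite divr_gt0.
  have [g [Ag gd]] := filter_ex (filterI FA (U _ d1)).
  apply: (@le_trans _ _ (\sum_(0 <= k < n)
      (supnorm (fun t => (h - g) t * tau t ^+ k)%R + (d / n.+1%:R)%:E))%E).
    apply: lee_sum => k _; apply: supnorm_le => t.
    apply: (@le_trans _ _ ((cmod ((h - g) t * tau t ^+ k)%R)%:E +
                           (cmod ((g t - f t) * tau t ^+ k)%R)%:E)%E).
      rewrite -EFinD lee_fin; apply: le_trans (cmodD _ _).
      by rewrite -mulrDl addrA subrK.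
    apply: leeD; first exact: (supnorm_ub (fun t => (h - g) t * tau t ^+ k)).
    by rewrite lee_fin.
  rewrite big_split /=; apply: leeD.
    apply: (@le_trans _ _ (segal_norm tau (h - g)%R)).
      by apply: nneseries_lim_ge => *; exact: supnorm_ge0.
    by rewrite -segal_rnormE lee_fin; exact/ltW/AP.
  rewrite sumEFin lee_fin sumr_const_nat subn0 -[_ *+ n]mulr_natr -mulrA ler_piMr ?ltW//.
  by rewrite mulrC ltr_pdivrMr// mul1r ltr_nat.
have fcont : continuous f.
  move=> t; apply/cvg_cmodP => e e0.
  have e3 : 0 < e / 2 / 2 by rewrite !divr_gt0.
  have [h hf] := filter_ex (U _ e3).
  have hf' s : cmod (h s - f s) <= e / 2 / 2 by have := hf 0%N s; rewrite expr0 mulr1.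
  have [[hc _] _] := in_segalP _ _ (segal_subproof h).
  have e2 : 0 < e / 2 by rewrite divr_gt0.
  have := (@cvg_cmodP R _ (nbhs t) (nbhs_filter t) h (h t)).1 (hc t) _ e2; apply: filterS => s hs.
  apply: le_lt_trans (cmodTri _ (h t) _) _; rewrite addrC.
  have := le_lt_trans (cmodTri (h t) (h s) (f s)) (ltr_leD hs (hf' s)) => h1.
  have h2 := hf' t; rewrite cmodB in h2.
  by have := ltr_leD h1 h2; rewrite -addrA -!splitr.
have f0 : C_0 f.
  split => // e e0; have e2 : 0 < e / 2 by rewrite divr_gt0.
  have [h hf] := filter_ex (U _ e2).
  have [[_ h0] _] := in_segalP _ _ (segal_subproof h).
  apply: (subclosed_compact (closed_cmod_ge fcont) (h0 _ e2)) => t /= et.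
  have := hf 0%N t; rewrite expr0 mulr1 cmodB => hft.
  have := cmodD (f t - h t) (h t); rewrite subrK => h2.
  have := le_trans (le_trans et h2) (lerD hft (lexx _)).
  by rewrite [leLHS](splitr e) lerD2l.
have fin : f \in in_segal tau.
  apply/in_segalP; split => //.
  have [h hf] := filter_ex (S 1 ltr01).
  have := segal_norm_scaleD tau (-1) ((h : R -> (R[i])^o) - f) h.
  rewrite (_ : (-1) *: _ + _ = f); last first.
    by rewrite scaleN1r opprB subrK.
  move/le_lt_trans; apply; rewrite normcN ComplexField.Normc.normc1 mul1e.
  rewrite lte_add_pinfty//; first exact: le_lt_trans hf (ltry _).
  by have /in_segalP[] := segal_subproof h.
pose f' := Segal fin.
apply/cvg_ex; exists f'; apply/cvgrPdist_le => e /complex_gt0E[-> e0].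
apply: filterS (S _ e0) => h /= hf.
by rewrite distrC segal_normE lecR -lee_fin (segal_rnormE (h - f')).
Qed.

End segal_complete.

HB.instance Definition _ (R : realType) (tau : R -> (R[i])^o) :=
  Uniform_isComplete.Build (segal tau) (@segal_cauchy_cvg R tau).

Record homeo (X : topologicalType) := Homeo {
  homeo_fun :> X -> X;
  homeo_inv : X -> X;
  homeoK : cancel homeo_fun homeo_inv;
  homeoVK : cancel homeo_inv homeo_fun;
  homeo_continuous : continuous homeo_fun;
  homeoV_continuous : continuous homeo_inv }.

Definition homeo_iter (X : topologicalType) (alpha : homeo X) (m : int) : X -> X :=
  match m with
  | Posz n => iter n alpha
  | Negz n => iter n.+1 (homeo_inv alpha)
  end.

Section weighted_composition.
Context {R : realType} (tau : R -> (R[i])^o) (w : R -> (R[i])^o) (alpha : homeo R).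
Hypothesis tau_alpha : tau \o alpha = tau.
Hypothesis w_Cb : C_b w.
Implicit Types f : segal tau.

Let wM : exists2 M : R, 0 < M & forall t, cmod (w t) <= M.
Proof. by apply: supnorm_fin; case: w_Cb. Qed.

Lemma segal_norm_wcomp (M : R) (f : R -> (R[i])^o) : 0 < M ->
  (forall t, cmod (w t) <= M) ->
  (segal_norm tau (fun t => w t * f (alpha t))%R <= M%:E * segal_norm tau f)%E.
Proof.
move=> M0 wM'; rewrite /segal_norm -nneseriesZl; last first.
  by move=> k _; exact: supnorm_ge0.
apply: lee_nneseries => [k _ _|k _]; first exact: supnorm_ge0.
apply: supnorm_le => t.
rewrite -{1}tau_alpha /= -mulrA cmodM EFinM; apply: lee_pmul.
- by rewrite lee_fin cmod_ge0.
- by rewrite lee_fin cmod_ge0.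
- by rewrite lee_fin wM'.
- exact: (supnorm_ub (fun t => f t * tau t ^+ k)%R).
Qed.

Lemma in_segal_wcomp f : (fun t => w t * f (alpha t)) \in in_segal tau.
Proof.
have [M M0 wM'] := wM.
have [[fc f0] ffin] := in_segalP _ _ (segal_subproof f).
have hc : continuous ((fun t => w t * f (alpha t)) : R -> (R[i])^o).
  move=> t; apply: (@continuousM _ _ w (f \o alpha)); first by case: w_Cb => + _; exact.
  by apply: continuous_comp; [exact: homeo_continuous|exact: fc].
apply/in_segalP; split; last first.
  apply: le_lt_trans (segal_norm_wcomp f M0 wM') _.
  by rewrite -segal_rnormE -EFinM ltry.
split=> // e e0; have eM : 0 < e / M by rewrite divr_gt0.
have aK : compact (homeo_inv alpha @` [set t | e / M <= cmod (f t)]).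
  apply: continuous_compact (f0 _ eM).
  exact/continuous_subspaceT/homeoV_continuous.
apply: (subclosed_compact (closed_cmod_ge hc) aK) => t /= et.
exists (alpha t); last exact: homeoK.
rewrite ler_pdivrMr//; apply: le_trans et _.
by rewrite cmodM mulrC ler_wpM2l// cmod_ge0.
Qed.

(* T_{alpha,w} f = w (f \o alpha) *)
Definition wcomp f : segal tau := Segal (in_segal_wcomp f).

Lemma wcomp_linear : linear wcomp.
Proof.
move=> c f g; apply/val_inj/funext => t /=.
rewrite /GRing.scale /= mulrDr; congr (_ + _).
by rewrite mulrCA.
Qed.

HB.instance Definition _ :=
  GRing.isLinear.Build R[i] (segal tau) (segal tau) _ wcomp wcomp_linear.

Lemma wcomp_bounded : bounded_near wcomp (nbhs 0).
Proof.
have [M M0 wM'] := wM.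
apply/linear_boundedP; near=> r => f.
apply: (@le_trans _ _ (M%:C%C * `|f|)); last first.
  by rewrite ler_wpM2r//; near: r; apply: nbhs_pinfty_ge; rewrite ger0_real// lecR ltW.
rewrite !segal_normE -rmorphM lecR -lee_fin EFinM.
rewrite (segal_rnormE (wcomp f)) (segal_rnormE f).
exact: segal_norm_wcomp.
Unshelve. all: by end_near. Qed.

End weighted_composition.

Definition separable (X : topologicalType) : Prop :=
  exists2 D : set X, countable D & dense D.

Definition infinite_dimensional (K : fieldType) (V : lmodType K) : Prop :=
  ~ exists (n : nat) (b : 'I_n -> V),
      forall v, exists c : 'I_n -> K, v = \sum_(i < n) c i *: b i.

Definition hypercyclic (K : numFieldType) (X : completeNormedModType K)
    (T : {linear X -> X}) : Prop :=
  exists x : X, dense [set iter n T x | n in [set: nat]].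

(* Main.v *)
Require Import Defs.
From mathcomp Require Import all_boot all_order all_algebra.
From mathcomp Require Import all_classical all_reals all_analysis.
From mathcomp Require Import complex.
From mathcomp Require Import lra ring.
Import Order.TTheory GRing.Theory Num.Theory numFieldNormedType.Exports.
Local Open Scope classical_set_scope.
Local Open Scope ring_scope.

(* (1) => (2): let F be a real bump function of the Segal algebra with F = 1 on
   K, and let h, T^n h be points of a dense orbit within q of F and of i F. Write
   P_n = prod_(j < n) w o alpha^j > 0. At t in K, T^n h = P_n (h o alpha^n) has
   imaginary part close to 1 while h has small imaginary part everywhere, so
   P_n t is large; at alpha^-n t, T^n h has small real part while Re (h t) is
   close to 1, so P_n (alpha^-n t) is small. The phase i separates the two
   targets even where alpha^n K meets the support of F.
   (2) => (1): functions supported in a compact K included in {|tau| <= e} with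
   e < 1 are dense, and for them all terms of the Segal norm are controlled by a
   geometric series and the suprema in (2); hence T^n f and the preimage of g
   under T^n are small for suitable n, T is topologically transitive, and the
   Baire category theorem applies. *)

Set Implicit Arguments.
Unset Strict Implicit.
Unset Printing Implicit Defensive.

(** * The modulus on the complex numbers *)

Section complex_modulus.
Context {R : realType}.
Implicit Types (z : R[i]) (c : R).

Lemma cmod_Re z : `|complex.Re z| <= cmod z.
Proof.
by case: z => a b /=; rewrite -sqrtr_sqr; apply: ler_wsqrtr; rewrite lerDl sqr_ge0.
Qed.

Lemma cmod_Im z : `|complex.Im z| <= cmod z.
Proof.
by case: z => a b /=; rewrite -sqrtr_sqr; apply: ler_wsqrtr; rewrite lerDr sqr_ge0.
Qed.

Lemma cmodC c : cmod (c%:C%C) = `|c|.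
Proof. by rewrite /= expr0n /= addr0 sqrtr_sqr. Qed.

Lemma cmodX z k : cmod (z ^+ k) = cmod z ^+ k.
Proof.
elim: k => [|k IH]; first by rewrite !expr0 ComplexField.Normc.normc1.
by rewrite !exprS cmodM IH.
Qed.

Lemma cmod_prod_le (z : nat -> (R[i])^o) (M : R) n :
  (forall j, cmod (z j) <= M) -> cmod (\prod_(0 <= j < n) z j) <= M ^+ n.
Proof.
move=> zM; elim: n => [|n IH].
  by rewrite big_geq// ComplexField.Normc.normc1.
by rewrite big_nat_recr//= exprSr cmodM ler_pM ?cmod_ge0.
Qed.

Lemma cmod_gt0 z : (0 < cmod z) = (z != 0).
Proof.
apply/idP/idP => [|z0]; first by apply: contraTneq => ->; rewrite ComplexField.Normc.normc0 ltxx.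
rewrite lt_neqAle cmod_ge0 andbT eq_sym; apply: contra_neq z0.
exact: ComplexField.Normc.eq0_normc.
Qed.

Lemma cmodV z : cmod z^-1 = (cmod z)^-1.
Proof.
have [->|z0] := eqVneq z 0; first by rewrite invr0 ComplexField.Normc.normc0 invr0.
have c0 : cmod z != 0 by rewrite gt_eqF// cmod_gt0.
by apply: (mulfI c0); rewrite -cmodM !mulfV// ComplexField.Normc.normc1.
Qed.

Lemma gt0_cmodE z : 0 < z -> z = (cmod z)%:C%C.
Proof. by move=> /complex_gt0E[-> h]; rewrite cmodC gtr0_norm. Qed.

Lemma continuous_realC {T : topologicalType} (r : T -> R^o) :
  continuous r -> continuous ((fun t => (r t)%:C%C) : T -> (R[i])^o).
Proof.
move=> rc t; apply/cvg_cmodP => e e0.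
have /cvgrPdist_lt/(_ e e0) := rc t.
by apply: filterS => s; rewrite -rmorphB cmodC.
Qed.

Lemma continuous_cmod {T : topologicalType} (f : T -> (R[i])^o) :
  continuous f -> continuous ((fun t => cmod (f t)) : T -> R^o).
Proof. by move=> fc t; apply: continuous_comp; [exact: fc|exact: cmod_continuous]. Qed.

End complex_modulus.

(** * Estimates for the Segal norm *)

Section segal_functions.
Context {R : realType} (tau : R -> (R[i])^o).
Implicit Types f g h : R -> (R[i])^o.

(** Wherever [f] is nonzero, the factor [tau ^+ k] has modulus at most [e ^+ k], so the series is
    dominated by a geometric one. *)
Lemma segal_norm_le_geometric f (e B : R) : 0 <= e < 1 -> 0 <= B ->
  (forall t, f t != 0 -> cmod (tau t) <= e) -> (forall t, cmod (f t) <= B) ->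
  (segal_norm tau f <= (B / (1 - e))%:E)%E.
Proof.
move=> /andP[e0 e1] B0 fe fB; apply: lime_le.
  by apply: is_cvg_nneseries => *; exact: supnorm_ge0.
apply: nearW => n; apply: (@le_trans _ _ (\sum_(0 <= k < n) (B * e ^+ k)%:E)%E).
  apply: lee_sum => k _; apply: supnorm_le => t; rewrite lee_fin cmodM cmodX.
  have [->|ft] := eqVneq (f t) 0.
    by rewrite ComplexField.Normc.normc0 mul0r mulr_ge0// exprn_ge0.
  by rewrite ler_pM ?cmod_ge0 ?exprn_ge0 ?cmod_ge0// lerXn2r ?nnegrE ?cmod_ge0 ?fe.
rewrite sumEFin lee_fin.
have -> : \sum_(0 <= k < n) B * e ^+ k = B * (1 - e ^+ n) / (1 - e).
  exact: (congr1 (fun u : R^nat => u n) (geometric_seriesE B (negbT (lt_eqF e1)))).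
by rewrite ler_pM2r ?invr_gt0 ?subr_gt0// ler_piMr// gerBl exprn_ge0.
Qed.

Lemma segal_norm_tail f (d : R) : (segal_norm tau f < +oo)%E -> 0 < d ->
  exists N, (\sum_(N <= k <oo) supnorm (fun t => f t * tau t ^+ k)%R <= d%:E)%E.
Proof.
move=> foo d0.
have ge0 k : xpredT k -> (0 <= supnorm (fun t => f t * tau t ^+ k)%R)%E.
  by move=> _; exact: supnorm_ge0.
have /(_ _ (open_ereal_lt' _)) := nneseries_tail_cvg foo ge0.
by move=> /(_ d%:E); rewrite lte_fin => /(_ d0)[N _ /(_ N (leqnn N)) /= /ltW h]; exists N.
Qed.

(* On the first terms of the series use the bound [eta], on the tail the bound by [f]. *)
Lemma segal_norm_dominated f (d : R) : (supnorm tau < +oo)%E ->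
  (segal_norm tau f < +oo)%E -> 0 < d -> exists2 eta : R, 0 < eta &
    forall g, (forall t, cmod (g t) <= eta) -> (forall t, cmod (g t) <= cmod (f t)) ->
      (segal_norm tau g <= d%:E)%E.
Proof.
move=> /supnorm_fin[M M0 tauM] foo d0; have d2 : 0 < d / 2 by rewrite divr_gt0.
have [N hN] := segal_norm_tail foo d2.
set S := \sum_(0 <= k < N) M ^+ k.
have S0 : 0 <= S by apply: sumr_ge0 => k _; rewrite exprn_ge0// ltW.
have S1 : 0 < S + 1 by rewrite ltr_wpDl.
exists (d / 2 / (S + 1)); first by rewrite divr_gt0.
move=> g g1 g2; rewrite /segal_norm (nneseries_split _ N); last first.
  by move=> k _; exact: supnorm_ge0.
rewrite add0n [d]splitr EFinD; apply: leeD; last first.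
  apply: le_trans hN; apply: lee_nneseries => [k _ _|k _]; first exact: supnorm_ge0.
  apply: supnorm_le => t; apply: le_trans (supnorm_ub (fun t => f t * tau t ^+ k) t).
  by rewrite lee_fin !cmodM ler_wpM2r ?cmod_ge0.
apply: (@le_trans _ _ (\sum_(0 <= k < N) (d / 2 / (S + 1) * M ^+ k)%:E)%E).
  apply: lee_sum => k _; apply: supnorm_le => t; rewrite lee_fin cmodM cmodX.
  by rewrite ler_pM ?cmod_ge0 ?exprn_ge0 ?cmod_ge0// lerXn2r ?nnegrE ?cmod_ge0// ltW.
rewrite sumEFin -mulr_sumr -/S lee_fin -[leLHS]mulrA; apply: ler_piMr; first exact: ltW.
by rewrite mulrC ler_pdivrMr// mul1r lerDl.
Qed.

(** If |tau t| were at least 1, every term of the series would be at least |f t|, and no tail could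
    fall to |f t| / 2. *)
Lemma segal_norm_tau_lt1 f t : (segal_norm tau f < +oo)%E -> f t != 0 -> cmod (tau t) < 1.
Proof.
rewrite -cmod_gt0 => foo f0; rewrite ltNge; apply/negP => tau1.
have [N hN] := segal_norm_tail foo (divr_gt0 f0 (ltr0Sn _ 1)).
have : ((cmod (f t))%:E <= (cmod (f t) / 2)%:E)%E.
  apply: le_trans hN; apply: (@le_trans _ _ (supnorm (fun t => f t * tau t ^+ N)%R)).
    apply: le_trans (supnorm_ub _ t); rewrite lee_fin cmodM cmodX ler_peMr ?cmod_ge0//.
    exact: exprn_ege1.
  rewrite (nneseries_split _ 1) => [|k _]; last exact: supnorm_ge0.
  rewrite addn1 big_nat1 leeDl// nneseries_ge0// => k _ _; exact: supnorm_ge0.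
by rewrite lee_fin leNgt ltr_pdivrMr// ltr_pMr// ltr1n.
Qed.

End segal_functions.

(** * Compactly supported approximants and bump functions *)

Section segal_approximation.
Context {R : realType} (tau : R -> (R[i])^o).

Lemma in_segal_le (f : segal tau) (g : R -> (R[i])^o) : continuous g ->
  (forall t, cmod (g t) <= cmod (f t)) -> g \in in_segal tau.
Proof.
move=> gc gf; have [[fc f0] ffin] := in_segalP _ _ (segal_subproof f).
apply/in_segalP; split.
  split=> // e e0; apply: subclosed_compact (closed_cmod_ge gc) (f0 _ e0) _ => t /= et.
  exact: le_trans et (gf t).
apply: le_lt_trans ffin; apply: lee_nneseries => [k _ _|k _]; first exact: supnorm_ge0.
apply: supnorm_le => t; apply: le_trans (supnorm_ub (fun t => f t * tau t ^+ k) t).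
by rewrite lee_fin !cmodM ler_wpM2r ?cmod_ge0.
Qed.

Lemma compact_cmod_lt1 (K : set R) : continuous tau -> compact K ->
  (forall t, K t -> cmod (tau t) < 1) ->
  exists2 e : R, 0 < e < 1 & K `<=` (fun t => cmod (tau t)) @^-1` `[0, e].
Proof.
move=> tauc Kc K1; have [->|/set0P K0] := eqVneq K set0.
  by exists 2^-1 => //; rewrite invr_gt0 ltr0n/= invf_lt1// ltr1n.
have [|c /set_mem Kc' cmax] := compact_EVT_max K0 Kc (f := fun t => cmod (tau t)).
  exact/continuous_subspaceT/continuous_cmod.
(* The midpoint between the maximum of |tau| on [K] and 1; the maximum itself could be 0, while [e]
   has to be positive. *)
exists ((cmod (tau c) + 1) / 2).
  by have := K1 _ Kc'; have := cmod_ge0 (tau c); lra.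
move=> t Kt; rewrite /= in_itv /= cmod_ge0 /=; have := cmax t (mem_set Kt).
by have := K1 _ Kc'; lra.
Qed.

(* Soft thresholding of [f] at height [eta]. *)
Lemma segal_approx (f : segal tau) (d : R) : C_b tau -> 0 < d ->
  exists (g : segal tau) (e : R) (K : set R), [/\ segal_rnorm (f - g) <= d, 0 < e < 1,
    compact K, K `<=` (fun t => cmod (tau t)) @^-1` `[0, e] & forall t, g t != 0 -> K t].
Proof.
move=> [tauc tauoo] d0; have [[fc f0] ffin] := in_segalP _ _ (segal_subproof f).
have [eta eta0 hd] := segal_norm_dominated tauoo ffin d0.
(* The factor (|f| - eta)^+ / |f|; raising the denominator to at least [eta] changes nothing where
   the numerator is nonzero and keeps [h] continuous at the zeros of [f]. *)
pose h t : R := Num.max 0 (cmod (f t) - eta) / Num.max eta (cmod (f t)).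
have den0 t : 0 < Num.max eta (cmod (f t)) by rewrite lt_max eta0.
have h0 t : cmod (f t) <= eta -> h t = 0.
  by move=> fe; rewrite /h (max_idPl _) ?mul0r// subr_le0.
have h1 t : eta <= cmod (f t) -> h t * cmod (f t) = cmod (f t) - eta.
  move=> fe; rewrite /h (max_idPr _) ?subr_ge0// (max_idPr _)// divfK//.
  by rewrite gt_eqF// (lt_le_trans eta0).
have h01 t : 0 <= h t <= 1.
  apply/andP; split; first by apply: divr_ge0; [rewrite le_max lexx|exact: ltW].
  rewrite ler_pdivrMr// mul1r ge_max le_max (ltW eta0) le_max gerBl (ltW eta0).
  by rewrite orbT.
pose g t : (R[i])^o := f t * (h t)%:C%C.
have gle t : cmod (g t) <= cmod (f t).
  have /andP[? ?] := h01 t.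
  by rewrite cmodM cmodC ger0_norm// ler_piMr// cmod_ge0.
have fc' : continuous ((fun t => cmod (f t)) : R -> R^o) by exact: continuous_cmod.
have gc : continuous g.
  move=> t; apply: (@continuousM _ _ f); first exact: fc.
  apply: continuous_realC => {}t; apply: (@continuousM R R (fun t => Num.max 0 (cmod (f t) - eta))
      (fun t => (Num.max eta (cmod (f t)))^-1)).
    apply: (@continuous_max R R (fun=> 0)); first exact: cst_continuous.
    apply: (@continuousB R R^o); [exact: fc'|exact: cst_continuous].
  apply: continuousV; first by rewrite gt_eqF.
  by apply: (@continuous_max R R (fun=> eta)); [exact: cst_continuous|exact: fc'].
have gS := in_segal_le gc gle.
have Kc := f0 _ eta0.
(* On the compact set where |f| >= eta, [f] does not vanish, which forces |tau| < 1 there. *)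
have [|e e01 Ke] := compact_cmod_lt1 tauc Kc.
  move=> t /= et; apply: (segal_norm_tau_lt1 ffin).
  by rewrite -cmod_gt0 (lt_le_trans eta0).
exists (Segal gS), e, [set t | eta <= cmod (f t)]; split => //; last first.
  move=> t /=; apply: contraNT; rewrite -ltNge => /ltW fe.
  by rewrite /g h0// mulr0.
have fg t : cmod ((f - Segal gS) t) = cmod (f t) * (1 - h t).
  have /andP[_ ht] := h01 t.
  rewrite -[1 - h t]ger0_norm ?subr_ge0// -cmodC -cmodM rmorphB mulrBr mulr1.
  by [].
(* The difference has modulus min(|f|, eta), so it satisfies both bounds required for domination. *)
rewrite -lee_fin segal_rnormE; apply: hd => t; rewrite fg; have /andP[ht0 ht1] := h01 t.
  have [fe|/ltW fe] := leP (cmod (f t)) eta; first by rewrite h0// subr0 mulr1.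
  by rewrite mulrBr mulr1 [_ * h t]mulrC h1// opprB addrC subrK.
by rewrite ler_piMr ?cmod_ge0// gerBl.
Qed.

(** The bump is a minimum of linear cut-offs in |t| and in |tau|. The first makes the support
    compact; the second keeps |tau| <= e' < 1 wherever the bump is nonzero, so its Segal norm is
    bounded by a geometric series. *)
Lemma segal_bump (e : R) (K : set R) : C_b tau -> 0 < e < 1 -> compact K ->
  K `<=` (fun t => cmod (tau t)) @^-1` `[0, e] ->
  exists2 F : segal tau, forall t, exists2 r : R, 0 <= r & F t = r%:C%C
    & forall t, K t -> F t = 1.
Proof.
move=> [tauc tauoo] /andP[e0 e1] Kc Ke.
have [A [_ KA]] : bounded_set (K : set R^o) by exact: compact_bounded.
set B := Num.max A 0 + 1.
have {}KA t : K t -> `|t| <= B.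
  by move=> Kt; apply: KA => //; rewrite /B ltr_pwDr// le_max lexx.
pose e' := (e + 1) / 2.
have ee' : e < e' by rewrite /e'; lra.
have e'1 : e' < 1 by rewrite /e'; lra.
pose r t : R := Num.max 0 (Num.min 1 (Num.min (B + 1 - `|t|) ((e' - cmod (tau t)) / (e' - e)))).
have r01 t : 0 <= r t <= 1 by rewrite /r le_max lexx ge_max ler01 ge_min lexx.
pose F t : (R[i])^o := (r t)%:C%C.
have rF t : cmod (F t) = r t by have /andP[? _] := r01 t; rewrite cmodC ger0_norm.
have rN t : r t != 0 -> `|t| <= B + 1 /\ cmod (tau t) <= e'.
  have /andP[r0 _] := r01 t; rewrite neq_lt ltNge r0 /=.
  rewrite /r lt_max ltxx /= !lt_min ltr01 /= subr_gt0 => /andP[/ltW ? ].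
  by rewrite pmulr_lgt0 ?invr_gt0 ?subr_gt0// => /ltW.
have Fc : continuous F.
  apply: continuous_realC => t.
  apply: (@continuous_max R R (fun=> 0) (fun t => Num.min 1
    (Num.min (B + 1 - `|t|) ((e' - cmod (tau t)) / (e' - e))))); first exact: cst_continuous.
  apply: (@continuous_min R R (fun=> 1)
    (fun t => Num.min (B + 1 - `|t|) ((e' - cmod (tau t)) / (e' - e)))); first exact: cst_continuous.
  apply: (@continuous_min R R (fun t => B + 1 - `|t|)
    (fun t => (e' - cmod (tau t)) / (e' - e))).
    apply: (@continuousB R R^o); first exact: cst_continuous.
    exact: norm_continuous.
  apply: (@continuousM R R (fun t => e' - cmod (tau t))); last exact: cst_continuous.
  apply: (@continuousB R R^o); first exact: cst_continuous.
  exact: continuous_cmod.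
have FS : F \in in_segal tau.
  apply/in_segalP; split.
    split=> // d d0; apply: subclosed_compact (closed_cmod_ge Fc) _ _.
      exact: (@segment_compact _ (- (B + 1)) (B + 1)).
    move=> t dr; have {}dr : d <= r t by rewrite -rF.
    rewrite /= in_itv /= -ler_norml.
    by apply: (rN t _).1; rewrite gt_eqF// (lt_le_trans d0).
  apply: le_lt_trans (ltry (1 / (1 - e'))); apply: segal_norm_le_geometric => // [|t|t].
  - by rewrite e'1 (ltW (lt_trans e0 ee')).
  - by move=> Ft; apply: (rN t _).2; rewrite -rF gt_eqF// cmod_gt0.
  - by rewrite rF; have /andP[] := r01 t.
exists (Segal FS) => t.
  by exists (r t) => //; have /andP[] := r01 t.
move=> Kt; rewrite -[LHS]/((r t)%:C%C); congr (_%:C%C); rewrite /r.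
have := Ke _ Kt; rewrite /= in_itv /= => /andP[_ te].
have ->: Num.min 1 (Num.min (B + 1 - `|t|) ((e' - cmod (tau t)) / (e' - e))) = 1.
  apply/min_idPl; rewrite le_min ler_pdivlMr ?subr_gt0// mul1r lerD2l lerN2 te andbT.
  by rewrite lerBrDr addrC lerD2r KA.
by apply/max_idPr.
Qed.

End segal_approximation.

(** * The topology of the Segal algebra in terms of its real norm, and Baire category *)

Section segal_topology.
Context {R : realType} (tau : R -> (R[i])^o).
Implicit Types f g h : segal tau.

Lemma segal_distC f g : segal_rnorm (f - g) = segal_rnorm (g - f).
Proof.
rewrite -opprB -scaleN1r segal_rnormZ normcN ComplexField.Normc.normc1.
by rewrite mul1r.
Qed.

Lemma segal_dist_triangle h f g :
  segal_rnorm (f - g) <= segal_rnorm (f - h) + segal_rnorm (h - g).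
Proof.
by apply: le_trans (segal_rnormD (f - h) (h - g)); rewrite addrA subrK.
Qed.

Lemma segal_ballE f (e : R) : ball f (e%:C%C : R[i]) = [set g | segal_rnorm (f - g) < e].
Proof. by rewrite -ball_normE; apply/funext => g /=; rewrite segal_normE ltcR. Qed.

Lemma segal_nbhsP f (A : set (segal tau)) :
  nbhs f A <-> exists2 e : R, 0 < e & forall g, segal_rnorm (f - g) < e -> A g.
Proof.
split=> [/nbhs_ballP[e /= /complex_gt0E[-> e0]]|[e e0 fA]].
  by rewrite segal_ballE => fA; exists (complex.Re e).
by apply/nbhs_ballP; exists (e%:C%C) => /=; rewrite ?ltcR// segal_ballE.
Qed.

Lemma segal_denseP (A : set (segal tau)) :
  dense A <-> forall f (e : R), 0 < e -> exists2 g, A g & segal_rnorm (f - g) < e.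
Proof.
split=> [Ad f e e0|Ad O [f Of] Oo].
  have [||g [fg Ag]] := Ad (ball f (e%:C%C : R[i]))%R; last first.
    by exists g => //; rewrite segal_ballE in fg.
  - by apply: ball_open; rewrite ltcR.
  - by exists f; apply: ballxx; rewrite ltcR.
have /segal_nbhsP[e e0 fO] : nbhs f O by exact: open_nbhs_nbhs.
by have [g Ag fg] := Ad f e e0; exists g; split => //; exact: fO.
Qed.

(* The Baire theorem of the library is restricted to spaces over a [realType]. *)
Lemma segal_baire (D : (set (segal tau))^nat) :
  (forall i, open (D i) /\ dense (D i)) -> \bigcap_i D i !=set0.
Proof.
move=> Dod.
(* A closed ball [s] inside [D j], with centre within r/2 of the old one and radius at most r/2 and
   1/(j+1), where r is the old radius; such balls are nested. Guarding by r > 0 makes the relation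
   total, as choice demands. *)
pose good (p : nat * (segal tau * R)) (s : segal tau * R) := 0 < p.2.2 ->
  [/\ 0 < s.2, s.2 <= p.2.2 / 2, s.2 <= p.1.+1%:R^-1, segal_rnorm (p.2.1 - s.1) <= p.2.2 / 2 &
    forall g, segal_rnorm (s.1 - g) <= s.2 -> D p.1 g].
have /choice[step stepP] : forall p, exists s, good p s.
  move=> [j [x r]]; have [r0|r0] := leP r 0; first by exists (x, r) => /=; rewrite /good /= ltNge r0.
  have r2 : 0 < r / 2 by rewrite divr_gt0.
  have [Do /segal_denseP Dd] := Dod j; have [x' Dx' /ltW xx'] := Dd x _ r2.
  have /segal_nbhsP[e e0 De] : nbhs x' (D j) by exact: open_nbhs_nbhs.
  exists (x', Num.min (e / 2) (Num.min (r / 2) j.+1%:R^-1)) => _ /=.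
  split => //.
  - by rewrite !lt_min r2 divr_gt0//= invr_gt0.
  - by rewrite !ge_min lexx orbT.
  - by rewrite !ge_min lexx !orbT.
  - move=> g; rewrite le_min => /andP[xg _]; apply: De; apply: le_lt_trans xg _.
    by rewrite ltr_pdivrMr// ltr_pMr// ltr1n.
have [s s0 sP] : exists2 s : nat -> segal tau * R, forall n, 0 < (s n).2
    & forall n, good (n, s n) (s n.+1).
  pose s := fix s n := if n is m.+1 then step (m, s m) else (0, 1 : R).
  exists s => n; last exact: stepP.
  by elim: n => [//|n /(stepP (n, s n))[]].
(* All later centres stay in the n-th closed ball: the next centre is within half the radius, and
   the next ball has at most half the radius. *)
have dist n k : segal_rnorm ((s n).1 - (s (n + k)%N).1) <= (s n).2.
  elim: k n => [|k IH] n; first by rewrite addn0 subrr segal_rnorm0 ltW.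
  have [_ r2 _ xx _] := sP n (s0 n); rewrite [leRHS]splitr addnS -addSn.
  exact: le_trans (segal_dist_triangle (s n.+1).1 _ _) (lerD xx (le_trans (IH n.+1) r2)).
have : cauchy ((fun n => (s n).1) @ \oo).
  apply/cauchyP => e /complex_gt0E[-> e0].
  have [n] : exists n, n.+1%:R^-1 < complex.Re e.
    exists (Num.trunc (complex.Re e)^-1); rewrite invf_plt ?posrE//; exact: truncnS_gt.
  move=> ne; exists (s n.+1).1; rewrite segal_ballE.
  exists n.+1 => // m /= nm; have [_ _ r1 _ _] := sP n (s0 n).
  rewrite -(subnKC nm); apply: le_lt_trans ne.
  exact: le_trans (dist n.+1 (m - n.+1)%N) r1.
move=> /cauchy_cvg/cvg_ex[l sl]; exists l => n _.
(* The limit stays in the closed ball number [n.+1], which lies inside [D n]. *)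
have [_ _ _ _ Dn] := sP n (s0 n); apply: Dn; apply/ler_addgt0Pr => e e0.
have [N _ lN] : \forall m \near \oo, segal_rnorm (l - (s m).1) < e.
  by apply: (sl [set g | segal_rnorm (l - g) < e]); apply/segal_nbhsP; exists e.
have := lN (n.+1 + N)%N (leq_addl _ _); rewrite segal_distC => /ltW lm.
exact: le_trans (segal_dist_triangle _ _ _) (lerD (dist n.+1 N) lm).
Qed.

End segal_topology.

(** * Suprema over a possibly empty set *)

Section sup_image.
Context {R : realType} {T : Type}.
Implicit Types (phi : T -> R) (K : set T).

Lemma sup_image_le phi K (d : R) : 0 <= d -> (forall t, 0 <= phi t) ->
  (forall t, K t -> phi t <= d) -> `|sup [set phi t | t in K]| <= d.
Proof.
(* For empty [K] the value of [sup] is 0, in accordance with the convention for non-negative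
   quantities. *)
move=> d0 phi0 phid; have [->|/set0P[t Kt]] := eqVneq K set0.
  by rewrite image_set0 sup0 normr0.
have phiub : ubound [set phi t | t in K] d by move=> _ [s Ks <-]; exact: phid.
rewrite ger0_norm; first by apply: ge_sup => //; exists (phi t), t.
by apply: le_trans (phi0 t) (ub_le_sup _ _); [exists d|exists t].
Qed.

Lemma image_le_sup phi K (M : R) t : (forall t, phi t <= M) -> K t ->
  phi t <= sup [set phi t | t in K].
Proof. by move=> phiM Kt; apply: ub_le_sup; [exists M => _ [s _ <-]|exists t]. Qed.

End sup_image.

(** * Iterates of the weighted composition operator *)

Section weighted_composition_iterates.
Context {R : realType} (tau w : R -> (R[i])^o) (alpha : homeo R).
Hypothesis tau_alpha : tau \o alpha = tau.
Hypothesis w_Cb : C_b w.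
Notation T := (wcomp tau_alpha w_Cb).
Implicit Types f g h : segal tau.

(** The multiplicative cocycle of [w] over [alpha], the weight of the n-th iterate of the operator.
    Both products of condition (2) reduce to it: one is its value at alpha^-n t, the other its
    reciprocal at t. *)
Definition orbit_prod n t : (R[i])^o := \prod_(0 <= j < n) w (homeo_iter alpha j%:Z t).

Lemma wcompE f t : T f t = w t * f (alpha t).
Proof. by []. Qed.

Lemma iter_wcompE n f t : iter n T f t = orbit_prod n t * f (iter n alpha t).
Proof.
elim: n t => [|n IH] t; first by rewrite /orbit_prod big_geq// mul1r.
rewrite iterS wcompE IH mulrA; congr (_ * _); last first.
  by rewrite -iterSr.
rewrite /orbit_prod big_nat_recl//; congr (_ * _).
by apply: eq_bigr => j _; rewrite /= -iterSr.
Qed.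

Lemma iter_homeoK n t : iter n alpha (iter n (homeo_inv alpha) t) = t.
Proof. by elim: n => [//|n IH]; rewrite iterSr iterS homeoVK. Qed.

Lemma homeo_iterB j n t : (j <= n)%N ->
  homeo_iter alpha (j%:Z - n%:Z) t = iter j alpha (iter n (homeo_inv alpha) t).
Proof.
move=> /subnKC <-; move: (n - j)%N => m; rewrite iterD iter_homeoK.
by rewrite PoszD opprD addrA subrr add0r; case: m.
Qed.

Lemma iter_homeoVK n t : iter n (homeo_inv alpha) (iter n alpha t) = t.
Proof. by elim: n => [//|n IH]; rewrite iterSr iterS homeoK. Qed.

Lemma tau_iter n t : tau (iter n alpha t) = tau t.
Proof. by elim: n => [//|n IH]; rewrite iterS -[LHS]/((tau \o alpha) _) tau_alpha. Qed.

Lemma orbit_prod_backward n t :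
  \prod_(0 <= j < n) w (homeo_iter alpha (j%:Z - n%:Z) t) =
  orbit_prod n (iter n (homeo_inv alpha) t).
Proof. by apply: eq_big_nat => j /andP[_ /ltnW jn]; rewrite homeo_iterB. Qed.

Lemma orbit_prodV n t :
  \prod_(0 <= j < n) (w (homeo_iter alpha j%:Z t))^-1 = (orbit_prod n t)^-1.
Proof. by rewrite /orbit_prod prodfV. Qed.

End weighted_composition_iterates.

(** * Extraction of increasing sequences and convergence to 0 *)

Lemma increasing_choice (P : nat -> nat -> Prop) :
  (forall k N, exists2 n, (N < n)%N & P k n) ->
  exists2 n_ : nat -> nat, increasing_seq n_ & forall k, P k (n_ k).
Proof.
move=> H; have /choice[F FP] : forall p : nat * nat, exists n, (p.2 < n)%N /\ P p.1 n.
  by move=> [k N]; have [n ? ?] := H k N; exists n.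
pose u := fix u k := if k is j.+1 then F (k, u j) else F (0%N, 0%N).
exists u; last by case=> [|k]; [exact: (FP (_, _)).2|exact: (FP (_, u k)).2].
by apply/increasing_seqP => k; rewrite ltEnat /=; exact: (FP (_, u k)).1.
Qed.

Lemma cvg0_le_harmonic (R : realType) (u : R^nat) :
  (forall k, `|u k| <= k.+1%:R^-1) -> u @ \oo --> 0.
Proof.
move=> uh; apply: norm_cvg0.
apply: (@squeeze_cvgr _ _ _ _ (fun=> 0) harmonic); [|exact: cvg_cst|exact: cvg_harmonic].
by apply: nearW => k; rewrite normr_ge0 uh.
Qed.

(** * Dense orbits and the decay of the weight products *)

Section hypercyclicity.
Context {R : realType} (tau w : R -> (R[i])^o) (alpha : homeo R).
Hypothesis tau_Cb : C_b tau.
Hypothesis tau_alpha : tau \o alpha = tau.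
Hypothesis w_Cb : C_b w.
Hypothesis w_gt0 : forall t, 0 < w t.
Hypothesis w_inv : (supnorm (fun t => (w t)^-1)%R < +oo)%E.
Notation T := (wcomp tau_alpha w_Cb).
Notation orbit_prod := (orbit_prod w alpha).
Notation alphaV n := (iter n (homeo_inv alpha)).
Implicit Types f g h : segal tau.

Lemma orbit_prod_gt0 n t : 0 < orbit_prod n t.
Proof. by rewrite /orbit_prod; apply: prodr_gt0 => j _; exact: w_gt0. Qed.

Lemma orbit_prod_neq0 n t : orbit_prod n t != 0.
Proof. by rewrite gt_eqF// orbit_prod_gt0. Qed.

Lemma cmod_orbit_prod_gt0 n t : 0 < cmod (orbit_prod n t).
Proof. by rewrite cmod_gt0 orbit_prod_neq0. Qed.

Lemma tau_alphaV : tau \o homeo_inv alpha = tau.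
Proof. by apply/funext => t /=; rewrite -{1}tau_alpha /= homeoVK. Qed.

(** The preimage comes from another weighted composition operator, with homeomorphism alpha^-1 and
    weight 1 / (w o alpha^-1), which is bounded because 1 / w is. *)
Lemma wcomp_surj g : exists f, T f = g.
Proof.
pose alphaI := Homeo (homeoVK alpha) (homeoK alpha) (@homeoV_continuous _ alpha)
  (@homeo_continuous _ alpha).
pose w' t : (R[i])^o := (w (homeo_inv alpha t))^-1.
have w'_Cb : C_b w'.
  split; last first.
    apply: le_lt_trans w_inv; apply: supnorm_le => t.
    exact: (supnorm_ub (fun t => (w t)^-1)).
  move=> t; apply: (@continuousV R[i] R (w \o homeo_inv alpha)).
    by rewrite gt_eqF// w_gt0.
  by apply: continuous_comp; [exact: homeoV_continuous|exact: (proj1 w_Cb)].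
have tau_alphaI : tau \o alphaI = tau by exact: tau_alphaV.
exists (wcomp tau_alphaI w'_Cb g); apply/val_inj/funext => t.
rewrite -[LHS]/(w t * ((w (homeo_inv alpha (alpha t)))^-1 * g (homeo_inv alpha (alpha t)))).
by rewrite homeoK mulrA mulfV ?mul1r// gt_eqF// w_gt0.
Qed.

Lemma iter_wcomp_surj n g : exists f, iter n T f = g.
Proof.
elim: n g => [|n IH] g; first by exists g.
by have [f <-] := wcomp_surj g; have [h <-] := IH f; exists h.
Qed.

Lemma continuous_iter_wcomp n : continuous (iter n T : segal tau -> segal tau).
Proof.
elim: n => [|n IH] f; first exact: cvg_id.
apply: (@continuous_comp _ _ _ (iter n T) T); first exact: IH.
exact: ((linear_bounded_continuous T).1 (wcomp_bounded tau_alpha w_Cb)).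
Qed.

(** A nonzero vector [v] excludes isolated points, so deleting finitely many terms preserves
    density. This allows the times in a dense orbit to be taken arbitrarily large. *)
Lemma dense_tail (u : nat -> segal tau) (v : segal tau) : 0 < segal_rnorm v -> dense (range u) ->
  forall N f (e : R), 0 < e -> exists2 n, (N <= n)%N & segal_rnorm (f - u n) < e.
Proof.
move=> v0 /segal_denseP ud; elim=> [|N IH] f e e0.
  by have [_ [n _ <-] fn] := ud f e e0; exists n.
have e2 : 0 < e / 2 by rewrite divr_gt0.
have [g fg gN] : exists2 g, segal_rnorm (f - g) < e / 2 & 0 < segal_rnorm (g - u N).
  have [f0|f0] : 0 < segal_rnorm (f - u N) \/ segal_rnorm (f - u N) <= 0.
    by apply/orP; rewrite ltNge orNb.
    by exists f; first by rewrite subrr segal_rnorm0.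
  (* If [f] coincides with [u N], it is shifted along [v] by a vector of norm e/4. *)
  pose c := e / 2 / 2 / segal_rnorm v.
  have c0 : 0 < c by rewrite !divr_gt0.
  have cv : segal_rnorm (c%:C%C *: v) = e / 2 / 2.
    by rewrite segal_rnormZ cmodC gtr0_norm// divfK// gt_eqF.
  have fg : segal_rnorm (f - (f + c%:C%C *: v)) = e / 2 / 2.
    by rewrite segal_distC addrC addrA addNr add0r.
  exists (f + c%:C%C *: v); first by rewrite fg ltr_pdivrMr// ltr_pMr// ltr1n.
  have := segal_dist_triangle (u N) f (f + c%:C%C *: v); rewrite fg => h.
  rewrite segal_distC; apply: lt_le_trans (_ : e / 2 / 2 <= _); first by rewrite divr_gt0.
  by apply: le_trans h _; rewrite gerDr.
(* A term closer to [g] than [u N] cannot have index [N], so [N <= n] becomes strict. *)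
have [|n Nn gn] := IH g (Num.min (e / 2) (segal_rnorm (g - u N))).
  by rewrite lt_min e2.
move: gn; rewrite lt_min => /andP[gn1 gn2]; exists n.
  by rewrite ltn_neqAle Nn andbT; apply: contraTneq gn2 => <-; rewrite ltxx.
apply: le_lt_trans (segal_dist_triangle g _ _) _.
by rewrite [ltRHS]splitr ltrD.
Qed.

Lemma small_orbit_prods (x : segal tau) (e d : R) (K : set R) N :
  dense [set iter n T x | n in [set: nat]] -> 0 < e < 1 -> compact K ->
  K `<=` (fun t => cmod (tau t)) @^-1` `[0, e] -> 0 < d ->
  exists2 n, (N < n)%N & forall t, K t ->
    cmod (orbit_prod n (alphaV n t)) <= d /\ cmod (orbit_prod n t)^-1 <= d.
Proof.
move=> xd e01 Kc Ke d0; have [->|/set0P[t0 Kt0]] := eqVneq K set0.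
  by exists N.+1.
have [F F0 F1] := segal_bump tau_Cb e01 Kc Ke.
(* The point [t0] of [K] makes [F] nonzero, as [dense_tail] requires of its vector. *)
have FN : 0 < segal_rnorm F.
  apply: lt_le_trans (cmod_le_segal_rnorm F t0).
  by rewrite F1// ComplexField.Normc.normc1.
(* Both halves end with the bound q / (1 - q), and this [q] makes it equal to [d]. *)
pose q := d / (1 + d).
have d1 : 0 < 1 + d by rewrite addr_gt0.
have q0 : 0 < q by rewrite divr_gt0.
have qd : d * (1 - q) = q by rewrite /q; field; rewrite gt_eqF.
have q1 : 0 < 1 - q by rewrite -(pmulr_rgt0 _ d0) qd.
have [m _ hm] := dense_tail FN xd 0 F q0.
(* The second time is taken beyond m + N, so that T^p x = T^n h with h = T^m x and n = p - m > N. *)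
have [p mNp hp] := dense_tail FN xd (m + N).+1 (('i%C : R[i]) *: F) q0.
have [n np Nn] : exists2 n, p = (n + m)%N & (N < n)%N.
  exists (p - m)%N; first by rewrite subnK// (leq_trans _ mNp)// -addnS leq_addr.
  by rewrite ltn_subRL.
exists n => // t Kt; move: hp; rewrite np iterD; move: (iter m T x) hm => h hF hT.
have close s : cmod (F s - h s) < q by exact: le_lt_trans (cmod_le_segal_rnorm (F - h) s) hF.
have closeT s : cmod ('i%C * F s - orbit_prod n s * h (iter n alpha s)) < q.
  rewrite -(iter_wcompE tau_alpha w_Cb).
  exact: le_lt_trans (cmod_le_segal_rnorm ('i%C *: F - iter n T h) s) hT.
split.
  (* Real parts: i F(s) contributes 0, so P_n(s) Re h(t) < q, while Re h(t) > 1 - q because F(t) =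
     1. *)
  set s := alphaV n t.
  have := closeT s; have [r r0 ->] := F0 s; rewrite /s iter_homeoK -/s.
  have := close t; rewrite F1//.
  have := gt0_cmodE (orbit_prod_gt0 n s).
  have := cmod_orbit_prod_gt0 n s.
  move: (orbit_prod n s) (cmod (orbit_prod n s)) (h t) => _ c [a b] c0 ->.
  move=> /(le_lt_trans (cmod_Re _)) ha /(le_lt_trans (cmod_Re _)) hb.
  move: ha hb => /=; rewrite !mul0r mulr0 subrr subr0 sub0r normrN => /ltr_distlDr a1 ca.
  rewrite -(ler_pM2r q1) qd; apply: le_trans (ltW (le_lt_trans (ler_norm _) ca)).
  by rewrite ler_wpM2l ?(ltW c0)// lerBlDr ltW.
(* Imaginary parts: P_n(t) Im h(alpha^n t) > 1 - q, while Im h(alpha^n t) < q because [F] is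
   real. *)
have := closeT t; rewrite F1// mulr1 cmodV.
have [r r0] := F0 (iter n alpha t); have := close (iter n alpha t) => + Fr; rewrite Fr.
have := gt0_cmodE (orbit_prod_gt0 n t).
have := cmod_orbit_prod_gt0 n t.
move: (orbit_prod n t) (cmod (orbit_prod n t)) (h (iter n alpha t)) => _ c [a b] c0 ->.
move=> /(le_lt_trans (cmod_Im _)) ha /(le_lt_trans (cmod_Im _)) hb.
move: ha hb => /=; rewrite mul0r addr0 sub0r normrN => /(le_lt_trans (ler_norm _)) bq.
move=> /ltr_distlDr cb; rewrite invf_ple ?posrE// -[d^-1]mul1r ler_pdivrMr//.
rewrite -(ler_pM2r q1) mul1r -mulrA qd lerBlDr (le_trans (ltW cb))//.
by rewrite lerD2r ler_wpM2l// ltW.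
Qed.

(** * From small products to a dense orbit *)

Hypothesis products : forall (e : R) (K : set R), 0 < e < 1 -> compact K ->
  K `<=` (fun t => cmod (tau t)) @^-1` `[0, e] -> forall d : R, 0 < d ->
  exists n, forall t, K t ->
    cmod (orbit_prod n (alphaV n t)) <= d /\ cmod (orbit_prod n t)^-1 <= d.

Lemma segal_rnorm_le_geometric f (e B : R) : 0 <= e < 1 -> 0 <= B ->
  (forall t, f t != 0 -> cmod (tau t) <= e) -> (forall t, cmod (f t) <= B) ->
  segal_rnorm f <= B / (1 - e).
Proof. by move=> *; rewrite -lee_fin segal_rnormE; exact: segal_norm_le_geometric. Qed.

Lemma iter_wcompD n f g : iter n T (f + g) = iter n T f + iter n T g.
Proof. by elim: n => [//|n IH]; rewrite !iterS IH linearD. Qed.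

(** The witness is x = f1 + u with T^n u = g1, where f1 and g1 approximate f and g and are supported
    in compact sets on which |tau| is bounded below 1. The error terms u and T^n f1 are both
    small. *)
Lemma wcomp_transitive f g (d : R) : 0 < d -> exists (x : segal tau) n,
  segal_rnorm (f - x) < d /\ segal_rnorm (g - iter n T x) < d.
Proof.
move=> d0; have d2 : 0 < d / 2 by rewrite divr_gt0.
have [f1 [e1 [K1 [ff1 /andP[e10 e11] K1c K1e f1K]]]] := segal_approx f tau_Cb d2.
have [g1 [e2 [K2 [gg1 /andP[e20 e21] K2c K2e g1K]]]] := segal_approx g tau_Cb d2.
pose e := Num.max e1 e2.
have e0 : 0 < e by rewrite lt_max e10.
have e1' : e < 1 by rewrite gt_max e11.
have K1e' : K1 `<=` (fun t => cmod (tau t)) @^-1` `[0, e].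
  by move=> t /K1e /=; rewrite !in_itv /= cmod_ge0 /= /e le_max => ->.
have K2e' : K2 `<=` (fun t => cmod (tau t)) @^-1` `[0, e].
  by move=> t /K2e /=; rewrite !in_itv /= cmod_ge0 /= /e le_max => ->; rewrite orbT.
pose C := segal_rnorm f1 + segal_rnorm g1 + 1.
have rnorm0 h : 0 <= segal_rnorm h by apply: le_trans (cmod_le_segal_rnorm h 0); exact: cmod_ge0.
have C0 : 0 < C by rewrite /C ltr_wpDl// addr_ge0.
(* Chosen so that the geometric bound with sup norm d' |f1| or d' |g1| stays below d/2; the summand
   1 in [C] makes this strict. *)
pose d' := d / 2 * (1 - e) / C.
have d'0 : 0 < d' by rewrite !divr_gt0// mulr_gt0// subr_gt0.
have small h : segal_rnorm h < C -> d' * segal_rnorm h / (1 - e) < d / 2.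
  move=> hC; have -> : d / 2 = d' * C / (1 - e).
    by rewrite /d'; field; rewrite !gt_eqF// subr_gt0.
  by rewrite ltr_pM2r ?invr_gt0 ?subr_gt0// ltr_pM2l.
have ee : 0 <= e < 1 by rewrite ltW.
(* Working on the union provides one [n] for both error terms. *)
have [||n nP] := @products e (K1 `|` K2) _ (compactU K1c K2c) _ d' d'0.
- by rewrite e0.
- by move=> t [/K1e'|/K2e'].
have [u un] := iter_wcomp_surj n g1.
have uE t : g1 (alphaV n t) = orbit_prod n (alphaV n t) * u t.
  rewrite -un iter_wcompE. by rewrite iter_homeoK.
(* Invariance of [tau] keeps |tau| <= e on supports moved by powers of [alpha], so the geometric
   bound applies to u and T^n f1 as well. *)
have tauV t : tau t = tau (alphaV n t) by rewrite -[RHS](tau_iter tau_alpha n) iter_homeoK.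
exists (f1 + u), n; rewrite iter_wcompD un; split.
  rewrite opprD addrA; apply: le_lt_trans (segal_rnormD _ _) _.
  rewrite -[- u]scaleN1r segal_rnormZ normcN ComplexField.Normc.normc1 mul1r.
  rewrite [ltRHS]splitr ler_ltD//; apply: le_lt_trans (small g1 _); last first.
    by rewrite /C ltr_pwDr// lerDr.
  apply: segal_rnorm_le_geometric => //; first by rewrite mulr_ge0// ltW.
    move=> t ut; rewrite tauV; have : g1 (alphaV n t) != 0.
      by rewrite uE mulf_neq0// orbit_prod_neq0.
    by move=> /g1K/K2e' /=; rewrite in_itv /= => /andP[].
  (* By [uE], |u t| is |g1| times the reciprocal product, both taken at alpha^-n t, a point of K2
     unless u t = 0. *)
  move=> t; have [->|ut] := eqVneq (u t) 0.
    by rewrite ComplexField.Normc.normc0 mulr_ge0// ltW.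
  have gK : K2 (alphaV n t) by apply: g1K; rewrite uE mulf_neq0// orbit_prod_neq0.
  have P0 := orbit_prod_neq0 n (alphaV n t).
  rewrite -[u t](mulKf P0) -uE cmodM; apply: ler_pM; rewrite ?cmod_ge0//.
    exact: (nP _ (or_intror gK)).2.
  exact: cmod_le_segal_rnorm.
rewrite (addrC (iter n T f1)) opprD addrA; apply: le_lt_trans (segal_rnormD _ _) _.
rewrite -[- iter n T f1]scaleN1r segal_rnormZ normcN ComplexField.Normc.normc1 mul1r.
rewrite [ltRHS]splitr ler_ltD//; apply: le_lt_trans (small f1 _); last first.
  by rewrite /C -addrA ltrDl ltr_wpDl.
apply: segal_rnorm_le_geometric => //; first by rewrite mulr_ge0// ltW.
  move=> t; rewrite iter_wcompE mulf_eq0 negb_or => /andP[_ /f1K/K1e'].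
  by rewrite /= tau_iter// in_itv /= => /andP[].
(* Unless f1 vanishes at alpha^n t, this point lies in K1, and the product at t is its backward
   product. *)
move=> t; rewrite iter_wcompE cmodM.
have [->|ft] := eqVneq (f1 (iter n alpha t)) 0.
  by rewrite ComplexField.Normc.normc0 mulr0 mulr_ge0// ltW.
apply: ler_pM; rewrite ?cmod_ge0//; last exact: cmod_le_segal_rnorm.
by have /= := (nP (iter n alpha t) (or_introl (f1K _ ft))).1; rewrite iter_homeoVK.
Qed.

(** Birkhoff's transitivity argument: points whose orbit enters a given ball form an open set, dense
    by transitivity. A point in the intersection of these sets over a countable family of balls has
    a dense orbit. *)
Lemma hypercyclic_of_products : separable (segal tau) -> hypercyclic T.
Proof.
move=> [D0 /countable_injP[idx idx_inj] /segal_denseP D0d].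
(* A left inverse of the numbering [idx] on [D0], with value 0 at numbers not attained. *)
pose y_ a := xget 0 [set y | D0 y /\ idx y = a].
have yD y : D0 y -> y_ (idx y) = y.
  move=> Dy; have [D1 i1] := @xgetPex _ 0 [set z | D0 z /\ idx z = idx y] (ex_intro _ y (conj Dy erefl)).
  by apply: idx_inj => //; exact: mem_set.
(* Pairs of a centre and a radius 1/(m+1) are enumerated by one index; a number that codes no pair
   merely repeats the pair (0, 0). *)
pose code j : nat * nat := odflt (0%N, 0%N) (unpickle j).
pose D j := \bigcup_n (iter n T @^-1` ball (y_ (code j).1) (((code j).2.+1%:R^-1 : R)%:C%C : R[i])).
have [|x xD] := @segal_baire _ _ D.
  move=> j; split.
    apply: bigcup_open => n _; apply: open_comp; last exact: ball_open.
    by move=> z _; exact: continuous_iter_wcomp.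
  apply/segal_denseP => f e e0; pose y := y_ (code j).1; pose m := (code j).2.
  have [|x [n [fx yx]]] := @wcomp_transitive f y (Num.min e m.+1%:R^-1).
    by rewrite lt_min e0 invr_gt0 ltr0n.
  move: fx yx; rewrite !lt_min => /andP[fx _] /andP[_ yx]; exists x => //.
  by rewrite /D; exists n => //=; rewrite segal_ballE.
exists x; apply/segal_denseP => f e e0; have e2 : 0 < e / 2 by rewrite divr_gt0.
have [y Dy fy] := D0d f _ e2.
have [m me] : exists m, m.+1%:R^-1 < e / 2.
  exists (Num.trunc (e / 2)^-1); rewrite invf_plt ?posrE//; exact: truncnS_gt.
have [n _] := xD (pickle (idx y, m)) I.
rewrite /= /code pickleK /= yD// segal_ballE /= => yx.
exists (iter n T x); first by exists n.
apply: le_lt_trans (segal_dist_triangle y _ _) _.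
by rewrite [ltRHS]splitr ltrD// (lt_trans yx).
Qed.
End hypercyclicity.

Theorem theorem3p10 (R : realType) (tau w : R -> (R[i])^o) (alpha : homeo R)
    (tau_Cb : C_b tau)
    (tau_alpha : tau \o alpha = tau)
    (w_Cb : C_b w)
    (w_gt0 : forall t, 0 < w t)
    (w_inv : (supnorm (fun t => (w t)^-1)%R < +oo)%E)
    (A_separable : separable (segal tau))
    (A_infinite_dimensional : infinite_dimensional (segal tau)) :
  hypercyclic (wcomp tau_alpha w_Cb) <->
  (forall (e : R) (K : set R), 0 < e < 1 -> compact K ->
     K `<=` (fun t => cmod (tau t)) @^-1` `[0, e] ->
     exists n_ : nat -> nat,
       [/\ increasing_seq n_,
           (fun k : nat => sup [set cmod (\prod_(0 <= j < n_ k)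
              w (homeo_iter alpha (j%:Z - (n_ k)%:Z) t)) | t in K]) @ \oo --> 0 &
           (fun k : nat => sup [set cmod (\prod_(0 <= j < n_ k)
              (w (homeo_iter alpha j%:Z t))^-1) | t in K]) @ \oo --> 0]).
Proof.
split=> [[x xd] e K e01 Kc Ke|H].
  have [k N|n_ n_incr n_small] := @increasing_choice (fun k n => forall t, K t ->
      cmod (orbit_prod w alpha n (iter n (homeo_inv alpha) t)) <= k.+1%:R^-1 /\
      cmod (orbit_prod w alpha n t)^-1 <= k.+1%:R^-1).
    have k0 : 0 < k.+1%:R^-1 :> R by rewrite invr_gt0.
    by have [n Nn hn] := small_orbit_prods tau_Cb w_gt0 N xd e01 Kc Ke k0; exists n.
  exists n_; split => //; apply: cvg0_le_harmonic => k; apply: sup_image_le => [|t|t Kt];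
    rewrite ?invr_ge0// ?cmod_ge0//.
    by rewrite orbit_prod_backward; exact: (n_small k t Kt).1.
  by rewrite orbit_prodV; exact: (n_small k t Kt).2.
apply: hypercyclic_of_products => // e K e01 Kc Ke d d0.
have [n_ [_ /cvgrPdist_lt/(_ d d0) hQ /cvgrPdist_lt/(_ d d0) hP]] := H e K e01 Kc Ke.
(* One index at which both suprema are below [d] is enough. *)
have [k [/= Qd Pd]] := filter_ex (filterI hQ hP).
(* Bounds on w and 1 / w bound the finite products over all t, so that [sup] really dominates each
   value on [K]. *)
have [M _ wM] := supnorm_fin (proj2 w_Cb).
have [M' _ wM'] := supnorm_fin w_inv.
exists (n_ k) => t Kt; rewrite -orbit_prod_backward -orbit_prodV; split.
  apply: le_trans (ltW (le_lt_trans (ler_norm _) _)); last first.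
    by rewrite sub0r normrN in Qd; exact: Qd.
  by apply: image_le_sup Kt => s; apply: cmod_prod_le => j; exact: wM.
apply: le_trans (ltW (le_lt_trans (ler_norm _) _)); last first.
  by rewrite sub0r normrN in Pd; exact: Pd.
by apply: image_le_sup Kt => s; apply: cmod_prod_le => j; exact: wM'.
Qed.
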